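(* Let $A$ be a countably infinite set, $U$ a countably infinite set, $s:A\to[U]^{<\omega}\setminus\{\varnothing\}$ a support assignment such that $X_F=\{a\in A:s(a)\cap F=\varnothing\}$ is nonempty for every finite $F\subseteq U$, and let $\mathcal F_s=\{X\subseteq A:\exists F\in[U]^{<\omega}\ X_F\subseteq X\}$. Let $B$ be a nonempty finite set, $Y=\omega\times B$, $E_N^B=[N,\infty)\times B$, and $\rho:A\to Y$ a map such that (S) for every finite $F\subseteq U$ there is $N$ such that for all $m\ge N$ and all $b\in B$ there is $a\in X_F$ with $\rho(a)=(m,b)$; (P) for every $N$ there is a finite $F_N\subseteq U$ with $X_{F_N}\subseteq\rho^{-1}(E_N^B)$. For $T\in L_{\mathcal F_s}(A)$ put $\pi_\rho(T)=\{\rho\circ t:t\in T\}$. Then $q_0=(\rho[A])^{<\omega}$ belongs to $\mathbb Q_B$, and $\pi_\rho$ is a map $L_{\mathcal F_s}(A)\to\mathbb Q_B\downarrow q_0=\{q\in\mathbb Q_B:q\le q_0\}$ which is order preserving, sends the largest condition to $q_0$, and satisfies $$\forall T\in L_{\mathcal F_s}(A)\ \ \forall q\in\mathbb Q_B\ \bigl(q\le\pi_\rho(T)\ \Rightarrow\ \exists S\le T\ \ \pi_\rho(S)\le q\bigr).$$ Thus $\pi_\rho$ is a complete projection onto the cone $\mathbb Q_B\downarrow q_0$. If $\rho$ is onto $Y$, the target is all of $\mathbb Q_B$.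
   Context: $[U]^{<\omega}$ is the set of finite subsets of $U$; $A^{<\omega}$ is the set of finite strings over $A$; $[N,\infty)=\{m\in\omega:m\ge N\}$. A filter on a countably infinite set is free if it contains every cofinite set and no finite set; $\mathcal F_s$ is a free filter under the stated hypotheses. For a free filter $\mathcal F$ on a countably infinite set $A$, the conditions of $L_{\mathcal F}(A)$ are the nonempty, downward-closed (closed under initial segments) trees $T\subseteq A^{<\omega}$ with a stem $\operatorname{stem}(T)$ (the longest node common to all branches; below it the tree has only one path) such that for every $t\in T$ with $t\supseteq\operatorname{stem}(T)$ the successor set $\operatorname{Succ}_T(t)=\{a:t^\frown a\in T\}$ belongs to $\mathcal F$. The order is $S\le T$ iff $S\subseteq T$, and the largest condition is the full tree $A^{<\omega}$. $\mathbb Q_B$ is the order, again by inclusion, of the analogous stemmed trees on $Y^{<\omega}$ in which every successor set at a node extending the stem contains some $E_N^B$. ''Complete projection'' means an order-preserving map sending the largest condition to the largest condition and having the displayed lifting property; surjectivity onto individual conditions is not required. *)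

(* Defs.v *)
From mathcomp Require Import all_boot.
From mathcomp Require Import finmap.
From mathcomp Require Import all_classical.

Set Implicit Arguments.
Unset Strict Implicit.
Unset Printing Implicit Defensive.

Local Open Scope classical_set_scope.
Local Open Scope card_scope.

Definition free_filter (A : Type) (F : set_system A) : Prop :=
  [/\ Filter F, forall X, cofinite_set X -> F X
    & forall X, finite_set X -> ~ F X].

Section Trees.
Variable A : choiceType.
Implicit Types (T : set (seq A)) (t u : seq A) (x : nat -> A) (D : set A).

(* The set of all finite strings with entries in D. *)
Definition strings D : set (seq A) := [set t | forall a, a \in t -> D a].

Definition is_tree T : Prop :=
  T !=set0 /\ forall t u, T u -> prefix t u -> T t.

Definition branch T x : Prop := forall n, T (mkseq x n).

Definition on_all_branches T t : Prop :=
  forall x, branch T x -> t = mkseq x (size t).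

(* The last clause says that T has only one path up to the stem; in particular
   it excludes dead ends there, which the infinite branches do not see. *)
Definition is_stem T t : Prop :=
  [/\ T t,
      on_all_branches T t,
      forall u, T u -> on_all_branches T u -> size u <= size t
    & forall u, T u -> size u <= size t -> prefix u t].

Definition Succ T t : set A := [set a | T (rcons t a)].

(* A stem is unique when it exists, so the existential speaks about stem(T). *)
Definition Lcond (F : set_system A) : set (set (seq A)) :=
  [set T | is_tree T /\
    exists2 r, is_stem T r & forall t, T t -> prefix r t -> F (Succ T t)].

End Trees.

Section Orders.
Variables X Z : Type.

(* A family of sets is regarded as a partial order under inclusion. *)
Definition is_largest (P : set (set X)) (p : set X) : Prop :=
  P p /\ forall p', P p' -> p' `<=` p.

Definition cone (P : set (set X)) (p : set X) : set (set X) :=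
  [set p' | P p' /\ p' `<=` p].

End Orders.

(* The largest conditions are required to exist. *)
Definition complete_projection (X Z : Type) (P : set (set X)) (Q : set (set Z))
    (f : set X -> set Z) : Prop :=
  [/\ forall p, P p -> Q (f p),
      forall p p', P p -> P p' -> p `<=` p' -> f p `<=` f p',
      exists2 top, is_largest P top & is_largest Q (f top)
    & forall p q, P p -> Q q -> q `<=` f p ->
        exists p', [/\ P p', p' `<=` p & f p' `<=` q]].

Definition avoid (A U : choiceType) (s : A -> {fset U}) (F : {fset U}) : set A :=
  [set a | (s a `&` F = fset0)%fset].

Definition support_filter (A U : choiceType) (s : A -> {fset U}) : set_system A :=
  filter_from [set: {fset U}] (avoid s).

Definition tail (B : finType) (N : nat) : set (nat * B) :=
  [set y | N <= y.1].

Definition QB (B : finType) : set (set (seq (nat * B))) :=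
  Lcond (filter_from [set: nat] (@tail B)).

Arguments QB B : clear implicits.

Definition proj_tree (A Y : choiceType) (rho : A -> Y) (T : set (seq A)) :
  set (seq Y) := map rho @` T.

Lemma support_filter_free (A U : choiceType) (s : A -> {fset U}) :
  (forall a, s a <> fset0) -> (forall F, avoid s F !=set0) ->
  free_filter (support_filter s).
Proof.
move=> s0 X0.
pose V (D : {fset A}) : {fset U} := (\bigcup_(a <- D) s a)%fset.
have avV (D : {fset A}) a : avoid s (V D) a -> a \notin D.
  move=> ha; apply/negP => aD; apply: (s0 a).
  rewrite -[RHS]ha; apply/esym/fsetIidPl.
  by apply: bigfcup_sup.
have avU F G : avoid s (F `|` G)%fset `<=` avoid s F `&` avoid s G.
  move=> a /eqP; rewrite /avoid /= fsetIUr fsetU_eq0 => /andP[/eqP ? /eqP ?].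
  by split.
split.
- apply: filter_from_filter; first by exists fset0.
  by move=> F G _ _; exists (F `|` G)%fset => //; exact: avU.
- move=> X /finite_fsetP[D XD]; exists (V D) => // a /avV aD.
  apply: contrapT => Xa; move/negP: aD; apply.
  by have : (~` X) a by []; rewrite XD.
- move=> X /finite_fsetP[D ->] [F _ FD].
  have [a /avU[/FD /= aD /avV]] := X0 (F `|` V D)%fset.
  by rewrite aD.
Qed.

Lemma tail_filter_free (B : finType) : 0 < #|B| ->
  free_filter (filter_from [set: nat] (@tail B)).
Proof.
move=> /card_gt0P[b _].
have bnd (D : {fset nat * B}) : exists N, forall y, y \in D -> y.1 < N.
  exists (\max_(y <- D) y.1).+1 => y yD.
  by rewrite ltnS; apply: leq_bigmax_seq.
split.
- apply: filter_from_filter; first by exists 0.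
  move=> M N _ _; exists (maxn M N) => // y; rewrite /tail /= geq_max.
  by case/andP.
- move=> X /finite_fsetP[D XD]; have [N hN] := bnd D.
  exists N => // y Ny; apply: contrapT => Xy.
  have yD : y \in D by have : (~` X) y by []; rewrite XD.
  by have := hN _ yD; rewrite ltnNge; move/negP; apply.
- move=> X /finite_fsetP[D ->] [N _ ND]; have [M hM] := bnd D.
  have /hM /= : (maxn M N, b) \in D by apply: ND; rewrite /tail /= leq_maxr.
  by rewrite ltnNge leq_maxl.
Qed.

Lemma is_stem_unique (A : choiceType) (T : set (seq A)) (r r' : seq A) :
  is_stem T r -> is_stem T r' -> r = r'.
Proof.
move=> [Tr rb rmax rone] [Tr' rb' rmax' rone'].
have E : size r = size r' by apply/eqP; rewrite eqn_leq rmax // rmax'.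
have := rone' _ Tr; rewrite E leqnn => /(_ isT).
by rewrite prefixE E take_size => /eqP.
Qed.

(* Main.v *)
(* In a tree of L_F every node is comparable with the stem, and above the stem
   nodes split into at least two, so a stem is any node r comparable with all
   others such that every successor set above r is in F. Applying rho
   preserves this because (S) makes the image of a set of F_s contain a tail.
   For the lifting, take t in T above stem(T) whose image lies in q above
   stem(q), and let S consist of the nodes of T comparable with t whose image is
   in q; above t its successor sets are intersections of a set of F_s with the
   preimage of a successor set of q, which is in F_s by (P). *)

Require Import Defs.
From mathcomp Require Import all_boot.
From mathcomp Require Import finmap.
From mathcomp Require Import all_classical.

Set Implicit Arguments.
Unset Strict Implicit.
Unset Printing Implicit Defensive.

Local Open Scope classical_set_scope.
Local Open Scope card_scope.

Lemma prefix_mkseq (A : eqType) (x : nat -> A) m n :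
  m <= n -> prefix (mkseq x m) (mkseq x n).
Proof.
move=> mn; rewrite prefixE size_mkseq /mkseq -map_take take_iota.
by rewrite (minn_idPl mn).
Qed.

Lemma comparable_prefix (A : eqType) (u v : seq A) :
  prefix u v || prefix v u -> size u <= size v -> prefix u v.
Proof.
case/orP=> // + uv; rewrite prefixE take_oversize // => /eqP ->.
exact: prefix_refl.
Qed.

Lemma prefix_comparable (A : eqType) (u v w : seq A) :
  prefix u w -> prefix v w -> prefix u v || prefix v u.
Proof.
rewrite !(prefixE _ w) => /eqP <- /eqP <-.
by case/orP: (leq_total (size u) (size v)) => le;
  rewrite -(take_takel w le) prefix_take ?orbT.
Qed.

Section StemmedTrees.
Variables (A : choiceType) (F : set_system A).
Implicit Types (T : set (seq A)) (r t u : seq A).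

(* Stems without reference to branches: [Lcond F T] amounts to [T] being a tree
   that is [stemmed] at some [r], since members of a free filter have two
   elements. *)
Definition stemmed T r : Prop :=
  [/\ T r, forall u, T u -> prefix u r || prefix r u
    & forall t, T t -> prefix r t -> F (Succ T t)].

(** A node longer than the stem is cut to the stem's length. The cut is a node no longer than the
    stem, so it is an initial segment of the stem, hence equal to it. *)
Lemma Lcond_stemmed T : Lcond F T -> is_tree T /\ exists r, stemmed T r.
Proof.
move=> [treeT [r [Tr _ _ oner] FT]]; split=> //; exists r; split=> // u Tu.
have [ur|/ltnW ru] := leqP (size u) (size r); first by rewrite oner.
have : prefix (take (size r) u) r.
  apply: oner; last by rewrite size_takel.
  exact: treeT.2 Tu (prefix_take _ _).
rewrite prefixE size_takel // take_size => /eqP ->.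
by rewrite prefix_take orbT.
Qed.

Lemma stemmed_prefix T r t :
  stemmed T r -> T t -> size r <= size t -> prefix r t.
Proof.
by move=> [_ compT _] Tt; apply: comparable_prefix; rewrite orbC compT.
Qed.

Hypothesis freeF : free_filter F.

Lemma free_filter_two (X : set A) : F X -> exists a b, [/\ X a, X b & a <> b].
Proof.
have [_ _ nfin] := freeF => FX; apply: contrapT => noab; apply: (nfin X _ FX).
have [->//|/set0P[a Xa]] := eqVneq X set0.
apply: (sub_finite_set (B := [set a])) => // b Xb.
by apply: contrapT => ba; apply: noab; exists b, a; split.
Qed.

(** Members of a free filter are nonempty, so a node above [r] extends one letter at a time without
    leaving [T]. *)
Lemma stemmed_branch T r t : is_tree T -> stemmed T r -> T t -> prefix r t ->
  exists2 x, branch T x & mkseq x (size t) = t.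
Proof.
move=> treeT [Tr _ FT] Tt rt.
(* [choice] yields a total function; away from nodes above [r] its value is irrelevant, and a member
   of [Succ T t] serves as filler. *)
have /choice[next nextP] u : exists a, T u -> prefix r u -> T (rcons u a).
  have [[Tu ru]|nTu] := pselect (T u /\ prefix r u).
    by have [a [_ [Ta _ _]]] := free_filter_two (FT u Tu ru); exists a.
  have [a _] := free_filter_two (FT t Tt rt).
  by exists a => Tu ru; case: nTu.
pose w n := iter n (fun u => rcons u (next u)) t.
have szw n : size (w n) = size t + n.
  by elim: n => [|n IH]; rewrite ?addn0 //= size_rcons IH addnS.
have Tw n : T (w n) /\ prefix r (w n).
  elim: n => [//|n [Twn rwn]]; split; first exact: nextP.
  exact: prefix_trans rwn (prefix_rcons _ _).
have ww m n : prefix (w m) (w (m + n)).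
  elim: n => [|n IH]; first by rewrite addn0 prefix_refl.
  by rewrite addnS; apply: prefix_trans IH (prefix_rcons _ _).
(* [w i.+1] has length [size t + i.+1], so the default [next t] is never read. *)
pose x i := nth (next t) (w i.+1) i.
have xw n : mkseq x (size t + n) = w n.
  apply: (@eq_from_nth _ (next t)); rewrite size_mkseq ?szw // => i ilt.
  rewrite nth_mkseq // /x.
  have pn (u v : seq A) : prefix u v -> i < size u ->
      nth (next t) u i = nth (next t) v i.
    by move=> /prefixP[z ->] iu; rewrite nth_cat iu.
  have iw : i < size (w i.+1) by rewrite szw ltn_addl.
  have [le|/ltnW le] := leqP i.+1 n.
    by apply: pn iw; rewrite -(subnKC le).
  by apply/esym; apply: pn; rewrite ?szw // -(subnKC le).
exists x; last by rewrite -{1}(addn0 (size t)) xw.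
move=> n; apply: (treeT.2 _ (w n)); first by case: (Tw n).
by rewrite -xw prefix_mkseq ?leq_addl.
Qed.

Lemma stemmed_Lcond T r : is_tree T -> stemmed T r -> Lcond F T.
Proof.
move=> treeT stT; have [Tr compT FT] := stT; split=> //; exists r => //.
have oner u : T u -> size u <= size r -> prefix u r.
  by move=> Tu; apply: comparable_prefix; exact: compT.
split=> // [x xT|u Tu ub].
  have := oner _ (xT (size r)); rewrite size_mkseq leqnn => /(_ isT).
  by rewrite prefixE size_mkseq take_size => /eqP.
rewrite leqNgt; apply/negP => ru.
have [a [b [Ta Tb ab]]] := free_filter_two (FT r Tr (prefix_refl r)).
(* Each [rcons r c] in [T] lies on a branch, so a longer node [u] common to all branches would carry
   every such [c] at position [size r]; two distinct successors exclude this. *)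
have nthu c : Succ T r c -> nth a u (size r) = c.
  move=> Tc.
  have [x xT] := stemmed_branch treeT stT Tc (prefix_rcons _ _).
  rewrite size_rcons => /(congr1 (nth a ^~ (size r))).
  rewrite nth_mkseq // nth_rcons ltnn eqxx => xr.
  by rewrite (ub x xT) nth_mkseq.
exact: ab (etrans (esym (nthu a Ta)) (nthu b Tb)).
Qed.

Lemma Lcond_setT : Lcond F [set: seq A].
Proof.
apply: (@stemmed_Lcond _ [::]).
  by split=> //; exists [::].
split=> // [u _|t _ _]; first by rewrite prefix0s orbT.
by have [FF _ _] := freeF; exact: filterT.
Qed.

End StemmedTrees.

Section Projection.
Variables (A Y : choiceType) (rho : A -> Y).
Implicit Types (T : set (seq A)) (q : set (seq Y)).

Lemma proj_treeS S T : S `<=` T -> proj_tree rho S `<=` proj_tree rho T.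
Proof. exact: image_subset. Qed.

Lemma proj_tree_setT : proj_tree rho [set: seq A] = strings (range rho).
Proof.
apply/seteqP; split=> [_ [t _ <-] b /mapP[a _ ->]|]; first by exists a.
elim=> [|b w IH] wP; first by exists [::].
have [a _ <-] := wP b (mem_head _ _).
have [|t _ <-] := IH; last by exists (a :: t).
by move=> c cw; apply: wP; rewrite inE cw orbT.
Qed.

Lemma is_tree_proj T : is_tree T -> is_tree (proj_tree rho T).
Proof.
move=> [[t0 Tt0] treeT]; split; first by exists (map rho t0), t0.
move=> w _ [t Tt <-]; rewrite prefixE => /eqP <-.
by rewrite -map_take; exists (take (size w) t) => //; apply: treeT (prefix_take _ _).
Qed.

Lemma map_prefix (r t : seq A) : prefix r t -> prefix (map rho r) (map rho t).
Proof. by rewrite !prefixE size_map -map_take => /eqP ->. Qed.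

Variables (F : set_system A) (G : set_system Y).
Hypotheses (freeF : free_filter F) (freeG : free_filter G).

Lemma Lcond_proj T : (forall X, F X -> G (rho @` X)) ->
  Lcond F T -> Lcond G (proj_tree rho T).
Proof.
move=> rhoG /Lcond_stemmed[treeT [r stT]]; have [Tr compT FT] := stT.
apply: (@stemmed_Lcond _ _ _ _ (map rho r)) => //; first exact: is_tree_proj.
split; first by exists r.
  by move=> _ [u /compT /orP[] ur <-]; rewrite (map_prefix ur) ?orbT.
(* [map rho r] does not determine [r], so only its length is kept: in [T], length alone puts [t]
   above [r]. *)
move=> _ [t Tt <-] /size_prefix; rewrite !size_map => rt.
have [GF _ _] := freeG.
(* Other preimages of the same node may contribute further successors; those of one [t] suffice. *)
apply: filterS (rhoG _ (FT t Tt (stemmed_prefix stT Tt rt))).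
by move=> _ [a Ta <-]; exists (rcons t a); rewrite ?map_rcons.
Qed.

Lemma Lcond_lift T q : (forall X, G X -> F (rho @^-1` X)) ->
  Lcond F T -> Lcond G q -> q `<=` proj_tree rho T ->
  exists S, [/\ Lcond F S, S `<=` T & proj_tree rho S `<=` q].
Proof.
move=> rhoF /Lcond_stemmed[treeT [r stT]] /Lcond_stemmed[treeq [w stq]] qT.
have [_ _ FT] := stT; have [qw _ Gq] := stq.
(* Any node of [q] above its stem can serve as stem of the projection of [S];
   one of length at least [size r] lifts to a node of [T] above [r]. *)
have [x qx xw] := stemmed_branch freeG treeq stq qw (prefix_refl w).
have [t0 Tt0 t0x] := qT _ (qx (size w + size r)).
have szt0 : size t0 = size w + size r by rewrite -(size_map rho) t0x size_mkseq.
have rt0 : prefix r t0 by apply: (stemmed_prefix stT); rewrite // szt0 leq_addl.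
have wt0 : prefix w (map rho t0).
  by rewrite t0x -{1}xw prefix_mkseq ?leq_addr.
pose S := [set t | [/\ T t, prefix t t0 || prefix t0 t & q (map rho t)]].
exists S; split; [|by move=> t []|by move=> _ [t [_ _ qt] <-]].
have St0 : S t0 by split; rewrite ?prefix_refl // t0x.
apply: (@stemmed_Lcond _ _ _ _ t0) => //.
  split; first by exists t0.
  move=> t u [Tu ut0 qu] tu; split; first exact: treeT.2 tu.
    case/orP: ut0 => [ut0|]; first by rewrite (prefix_trans tu).
    exact: prefix_comparable tu.
  exact: treeq.2 qu (map_prefix tu).
split=> // [u []//|t [Tt _ qt] t0t].
have [FF _ _] := freeF.
(* [t] is above [r] through [t0], and [map rho t] is above [w] through [map rho t0]. *)
apply: filterS (filterI (FT t Tt (prefix_trans rt0 t0t)) (rhoF _ (Gq _ qt _))).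
  move=> a [Ta qa]; split=> //.
    by rewrite (prefix_trans t0t (prefix_rcons _ _)) orbT.
  by rewrite map_rcons.
exact: prefix_trans wt0 (map_prefix t0t).
Qed.

End Projection.

Theorem theorem2p3 (A U : choiceType)
    (hA : [set: A] #= [set: nat]) (hU : [set: U] #= [set: nat])
    (s : A -> {fset U}) (hs : forall a, s a <> fset0)
    (hX : forall F : {fset U}, avoid s F !=set0)
    (B : finType) (hB : 0 < #|B|) (rho : A -> nat * B)
    (hS : forall F : {fset U}, exists N, forall m b, N <= m ->
       exists2 a, avoid s F a & rho a = (m, b))
    (hP : forall N, exists F : {fset U}, avoid s F `<=` rho @^-1` tail N) :
  let L := Lcond (support_filter s) in
  let Q := QB B in
  let q0 := strings (range rho) in
  let pi := proj_tree rho in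
  Q q0 /\
  (forall T, L T -> cone Q q0 (pi T)) /\
  (forall S T, L S -> L T -> S `<=` T -> pi S `<=` pi T) /\
  (is_largest L [set: seq A] /\ pi [set: seq A] = q0) /\
  (forall T q, L T -> Q q -> q `<=` pi T ->
     exists S, [/\ L S, S `<=` T & pi S `<=` q]) /\
  complete_projection L (cone Q q0) pi /\
  ((forall y, exists a, rho a = y) ->
     cone Q q0 = Q /\ complete_projection L Q pi).
Proof.
move=> L Q q0 pi.
have freeF := support_filter_free hs hX.
have freeG := tail_filter_free hB.
(* In [hS] one [N] serves all [b] at once, which gives a whole tail. *)
have image_tail X : support_filter s X ->
    filter_from [set: nat] (@tail B) (rho @` X).
  move=> [F _ FX]; have [N hN] := hS F; exists N => // -[m b] /= Nm.
  by have [a /FX Xa <-] := hN m b Nm; exists a.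
have preimage_support X : filter_from [set: nat] (@tail B) X ->
    support_filter s (rho @^-1` X).
  move=> [N _ NX]; have [F hF] := hP N; exists F => // a /hF; exact: NX.
have LT : L [set: seq A] by exact: Lcond_setT.
have largeT : is_largest L [set: seq A] by split.
have piT : pi [set: seq A] = q0 by exact: proj_tree_setT.
have piQ T : L T -> Q (pi T) by exact: Lcond_proj.
have piq0 T : pi T `<=` q0 by rewrite -piT; exact: proj_treeS.
(* [q0] is a condition because it is the projection of the full tree. *)
have Qq0 : Q q0 by rewrite -piT; exact: piQ.
have lift T q : L T -> Q q -> q `<=` pi T ->
    exists S, [/\ L S, S `<=` T & pi S `<=` q] by exact: Lcond_lift.
have piC T : L T -> cone Q q0 (pi T) by move=> /piQ QT; split.
have cproj : complete_projection L (cone Q q0) pi.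
  split=> //; first by move=> S T _ _; exact: proj_treeS.
    exists [set: seq A] => //; split=> [|p [_ pq0]]; first exact: piC.
    by rewrite piT.
  by move=> T q LT' [Qq _]; exact: lift.
do 2![split=> //]; split; first by move=> S T _ _; exact: proj_treeS.
do 3![split=> //]; move=> onto.
have QE : cone Q q0 = Q; last by split=> //; move: cproj; rewrite QE.
apply/seteqP; split=> [q [] //|q Qq]; split=> // w _ b _.
by have [a <-] := onto b; exists a.
Qed.
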